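(* Let $K$ be a natural number and $l>0$ a natural number. For every coloring $\chi:F_{\omega,K}\to l$ such that each color class $\chi^{-1}(\{m\})$, $m<l$, is Borel, there exists $(r_0,c_0)\in F_{\omega,\omega}$ such that the set $$F_{\omega,K}\cdot(r_0,c_0)=\{(s,j)\cdot(r_0,c_0):(s,j)\in F_{\omega,K}\}$$ is monochromatic for $\chi$.
   Context: Conventions: $\omega=\{0,1,2,\dots\}$ and each natural number $K$ is identified with $\{0,\dots,K-1\}$ with its usual order. For $K\le L\le\omega$, $F_{L,K}$ is the set of all pairs $(r,c)$ with $r:L\to K$, $c:K\to L$ a strictly increasing map, such that for all $x\in K$ and $y\in L$: $r(c(x))=x$, and $y\le c(x)$ implies $r(y)\le x$ (such pairs are called connections; $r$ is then a rigid surjection, i.e. a surjection mapping initial segments onto initial segments). Composition: for $(s,j)\in F_{L,K}$ and $(r,c)\in F_{M,L}$ with $K\le L\le M\le\omega$, $(s,j)\cdot(r,c)=(s\circ r,\,c\circ j)\in F_{M,K}$. For finite $K$, $F_{\omega,K}$ carries the topology it inherits as a subspace of the product $K^{\omega}\times\omega^{K}$ of discrete spaces (equivalently, basic open sets are the sets $\{(s,j)\in F_{\omega,K}: s\upharpoonright L=t,\ j=i\}$ for $(t,i)\in F_{L,K}$, $L<\omega$); ''Borel'' refers to this topology. *)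

(* Defs.v *)
From mathcomp Require Import all_boot all_order all_algebra.
From mathcomp Require Import all_classical topology measurable_structure.

Set Implicit Arguments.
Unset Strict Implicit.
Unset Printing Implicit Defensive.

Import Order.TTheory.

Local Open Scope classical_set_scope.
Local Open Scope order_scope.

(* K^L x L^K, both factors being products of discrete spaces. *)
Definition map_pair dL dK (L : orderType dL) (K : orderType dK) : Type :=
  ({ptws L -> discrete_topology K} * {ptws K -> discrete_topology L})%type.

(* F_{L,K}. A natural number K is represented by 'I_K and omega by nat. Used as
   a type, this set is the corresponding sigma type; it carries the topology
   induced by the inclusion into map_pair L K. *)
Definition connections dL dK (L : orderType dL) (K : orderType dK) :
    set (map_pair L K) :=
  [set rc : map_pair L K | [/\ {homo rc.2 : x y / x < y},
    (forall x : K, rc.1 (rc.2 x) = x)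
    & (forall (x : K) (y : L), y <= rc.2 x -> rc.1 y <= x)]].
Arguments connections {dL dK} L K.

Section composition.
Context dK dL dM (K : orderType dK) (L : orderType dL) (M : orderType dM).

Definition pair_comp (sj : map_pair L K) (rc : map_pair M L) : map_pair M K :=
  (sj.1 \o rc.1, rc.2 \o sj.2).

Lemma pair_comp_connections (sj : connections L K) (rc : connections M L) :
  pair_comp (val sj) (val rc) \in connections M K.
Proof.
case: sj rc => [[s j] /= /set_mem[/= jh sj sle]].
case=> [[r c] /= /set_mem[/= ch rc rle]].
apply/mem_set; split => /= [x y xy|x|x y yx].
- exact/ch/jh.
- by rewrite rc sj.
- exact/sle/rle.
Qed.

Definition conn_comp (sj : connections L K) (rc : connections M L) :
    connections M K :=
  exist _ (pair_comp (val sj) (val rc)) (pair_comp_connections sj rc).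

End composition.

Definition borel (T : topologicalType) : set (set T) := <<s open >>.

(* The color is required to exist, so an empty set is monochromatic only when
   there is at least one color. *)
Definition monochromatic (T C : Type) (chi : T -> C) (A : set T) : Prop :=
  exists m : C, A `<=` chi @^-1` [set m].

(* Main.v *)
Require Import Defs.
From mathcomp Require Import all_boot all_order all_algebra.
From mathcomp Require Import all_classical topology measurable_structure.
From mathcomp Require Import zify.

(* A connection (r, c) from omega to omega is a sequence of words: the block
   between two consecutive marks c(y-1) and c(y) is a word in the letters
   0, ..., y that ends in y, that is, a word over the alphabet {0, ..., y-1}
   with a variable y, ending in the variable. Composition substitutes letters
   for the variables.

   Borel sets have the property of Baire. A fusion argument, inserting finite
   words one after the other, gives e such that the color of (s, j) . e is
   decided by a neighborhood for every (s, j), hence depends only on j and on s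
   up to the last mark j(K-1).

   For colorings that depend only on that finite part, the theorem is proved by
   induction on K. When the part up to the mark of K-1 is given, the part from
   there to the mark of K is an arbitrary word over {0, ..., K} ending in K,
   where only the letters below K are already available as constants: this is a
   word over {0, ..., K-1} ending in a variable. A form of Carlson's theorem on
   variable words, proved with idempotent ultrafilters, and a second fusion make
   the color independent of this word, and the induction hypothesis applies. *)

Set Implicit Arguments.
Unset Strict Implicit.
Unset Printing Implicit Defensive.

Local Open Scope classical_set_scope.

(** * Ultrafilters on a semigroup *)

Section ultrafilters.
Context (T : Type).
Implicit Types (F p : set_system T) (A B : set T).

Lemma ultraP p : ProperFilter p -> (forall A, p A \/ p (~` A)) -> UltraFilter p.
Proof.
move=> pP pA; split=> // G GP pG; apply/seteqP; split=> // A GA.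
case: (pA A) => // /pG GnA; exfalso; apply: (@filter_not_empty _ G GP).
by rewrite -(setICr A); apply: filterI.
Qed.

Lemma ultra_setC p A : UltraFilter p -> ~ p A <-> p (~` A).
Proof.
move=> pU; split=> [npA|pnA pA].
  by case: (in_ultra_setVsetC A pU).
apply: (@filter_not_empty _ p _).
by rewrite -(setICr A); apply: filterI.
Qed.

Lemma ultra_sub_eq p F : UltraFilter p -> ProperFilter F -> p `<=` F -> F = p.
Proof. by move=> pU FP; exact: max_filter. Qed.

End ultrafilters.

Section filters.
Context (T : Type).
Implicit Types (F p : set_system T).

Lemma ultra_fmap U (f : T -> U) p : UltraFilter p -> UltraFilter (fmap f p).
Proof.
move=> pU; apply: ultraP => A.
by rewrite !fmapE preimage_setC; exact: in_ultra_setVsetC.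
Qed.

(** In terms of closed sets of ultrafilters this is an intersection. [G] will be a family
    [traces x z], which is closed under intersections but need not be upward closed. *)
Definition filter_join (F G : set_system T) : set_system T :=
  [set B | exists D E, [/\ F D, G E & D `&` E `<=` B]].

Lemma filter_join_proper F (G : set_system T) : ProperFilter F ->
  G setT -> setI_closed G ->
  (forall D E, F D -> G E -> D `&` E !=set0) -> ProperFilter (filter_join F G).
Proof.
move=> FP GT GI FG; split; first by move=> [D [E [FD GE]]]; case: (FG _ _ FD GE) => x DE /(_ x DE).
split.
- by exists setT, setT; split=> //; exact: filterT.
- move=> A B [D [E [FD GE DE]]] [D' [E' [FD' GE' DE']]].
  exists (D `&` D'), (E `&` E'); split; [exact: filterI|exact: GI|].
  by move=> x [[? ?] [? ?]]; split; [apply: DE|apply: DE'].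
- move=> A B AB [D [E [FD GE DE]]]; exists D, E; split=> //.
  exact: subset_trans AB.
Qed.

Lemma filter_joinl F (G : set_system T) : G setT -> F `<=` filter_join F G.
Proof. by move=> GT A FA; exists A, setT; split=> // x []. Qed.

Lemma filter_joinr F (G : set_system T) : Filter F -> G `<=` filter_join F G.
Proof. by move=> FF A GA; exists setT, A; split; [exact: filterT| |move=> x []]. Qed.

Lemma maximal_filter (Q : set_system T -> Prop) F0 :
    ProperFilter F0 -> Q F0 ->
    (forall C : set (set_system T), C !=set0 -> total_on C subset ->
      (forall F, C F -> ProperFilter F /\ Q F) -> Q (\bigcup_(F in C) F)) ->
  exists M, [/\ ProperFilter M, Q M, F0 `<=` M &
    forall F, ProperFilter F -> Q F -> M `<=` F -> F = M].
Proof.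
move=> P0 Q0 Qchain.
pose good (F : set_system T) := [/\ ProperFilter F, Q F & F0 `<=` F].
(* The alternative [F = set0] accounts for the empty chain, whose union is empty. *)
have [|M [Mgood Mmax]] := @Zorn_bigcup _ (fun F => F = set0 \/ good F).
  move=> C Cgood Ctot.
  have [[F1 [CF1 good1]]|noF] := pselect (exists F, C F /\ good F); last first.
    left; apply/seteqP; split=> // A [F CF FA]; case: (Cgood _ CF) => [F_0|gF].
      by move: FA; rewrite F_0.
    by case: noF; exists F.
  right.
  pose C' := [set F | C F /\ good F].
  have -> : \bigcup_(F in C) F = \bigcup_(F in C') F.
    apply/seteqP; split=> A [F CF FA]; exists F => //; last by case: CF.
    by case: (Cgood _ CF) => [F_0|gF //]; move: FA; rewrite F_0.
  have C'tot : total_on C' subset.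
    by move=> F G [CF _] [CG _]; exact: Ctot.
  have [P1 Q1 sub1] := good1.
  split.
  - split; first by move=> [F [_ [FP _ _]]]; exact: filter_not_empty.
    split.
    + by exists F1 => //; exact: filterT.
    + move=> A B [F C'F FA] [G C'G GB].
      have [_ [FP _ _]] := C'F; have [_ [GP _ _]] := C'G.
      case: (C'tot F G C'F C'G) => sub.
        by exists G => //; apply: filterI => //; exact: sub.
      by exists F => //; apply: filterI => //; exact: sub.
    + move=> A B AB [F C'F FA]; exists F => //.
      by have [_ [FP _ _]] := C'F; exact: filterS FA.
  - apply: Qchain => //; first by exists F1.
    by move=> F [_ [? ? _]].
  - by move=> A F0A; exists F1 => //; exact: sub1.
case: Mgood => [M0|[MP MQ subM]].
  exfalso; apply: (Mmax F0); last by right; split.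
  by rewrite M0; split=> // s; exact: (s setT (filterT)).
exists M; split=> // F FP FQ MF; apply: contrapT => FM.
apply: (Mmax F); last by right; split=> //; exact: subset_trans MF.
by split=> // FM'; apply: FM; apply/seteqP; split.
Qed.

End filters.

Section filter_semigroup.
Context (T : Type) (op : T -> T -> T).
Hypothesis opA : associative op.
Implicit Types (F p q x y z : set_system T) (A : set T).

(** On ultrafilters this is the product of the Stone-Cech compactification. For a filter [F] and an
    ultrafilter [x], the closed set of [F ** x] consists of the [y ** x] with [y] in the closed set
    of [F]. *)
Definition fprod p q : set_system T :=
  [set A | p [set s | q [set t | A (op s t)]]].
Local Notation "p ** q" := (fprod p q) (at level 40, left associativity).

Lemma fprodA p q z : p ** q ** z = p ** (q ** z).
Proof.
rewrite /fprod; apply/funext => A /=; congr p; apply/funext => s /=; congr q.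
by apply/funext => t /=; congr z; apply/funext => u /=; rewrite opA.
Qed.

Lemma fprod_filter F p : Filter F -> Filter p -> Filter (F ** p).
Proof.
move=> FF pF; split.
- by rewrite /fprod /=; apply: filterE => s; exact: filterT.
- move=> A B; rewrite /fprod /= => FA FB; apply: filterS (filterI FA FB) => s [].
  exact: filterI.
- move=> A B AB; rewrite /fprod /=; apply: filterS => s; apply: filterS => t; exact: AB.
Qed.

Lemma fprod_proper F p : ProperFilter F -> ProperFilter p -> ProperFilter (F ** p).
Proof.
move=> FP pP; split; last exact: fprod_filter.
rewrite /fprod /= => F0; apply: (@filter_not_empty _ F _); apply: filterS F0 => s /= p0.
by case: (@filter_not_empty _ p _).
Qed.

Lemma fprod_ultra p q : UltraFilter p -> UltraFilter q -> UltraFilter (p ** q).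
Proof.
move=> pU qU; apply: ultraP => [|A]; first exact: fprod_proper.
rewrite /fprod /=; have [pA|pA] := in_ultra_setVsetC [set s | q [set t | A (op s t)]] pU.
  by left.
by right; apply: filterS pA => s /= nq; exact: (ultra_setC _ qU).1.
Qed.

(** For ultrafilters, [y ** x = z] holds exactly when [y] contains this family. *)
Definition traces x z : set_system T :=
  [set B | exists2 A, z A & B = [set s | x [set t | A (op s t)]]].

Lemma tracesT x z : Filter x -> Filter z -> traces x z setT.
Proof.
by move=> xF zF; exists setT; [exact: filterT|apply/seteqP; split=> // s _; exact: filterT].
Qed.

Lemma tracesI x z : Filter x -> Filter z -> setI_closed (traces x z).
Proof.
move=> xF zF _ _ [A zA ->] [B zB ->]; exists (A `&` B); first exact: filterI.
apply/seteqP; split=> s /=; first by move=> [? ?]; exact: filterI.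
by move=> xs; split; apply: filterS xs => t [].
Qed.

(** The map from [y] to [y ** x] is continuous, so it maps compact sets to closed sets. Concretely,
    if some [D] in [F] missed the trace of some [A] in [z], the complement of [A] would be in
    [F ** x], hence in [z]. So [F] and the traces lie in a common ultrafilter. *)
Lemma fprod_lift F x z : ProperFilter F -> UltraFilter x -> UltraFilter z ->
  F ** x `<=` z -> exists2 y, UltraFilter y & F `<=` y /\ z = y ** x.
Proof.
move=> FP xU zU Fxz.
pose G := traces x z.
have GT : G setT by exact: tracesT.
have JP : ProperFilter (filter_join F G).
  apply: filter_join_proper => //; first exact: tracesI.
  move=> D _ FD [A zA ->].
  apply: contrapT => DE; move: zA; apply/ultra_setC; apply: Fxz.
  apply: filterS FD => s Ds; apply: (ultra_setC [set t | A (op s t)] xU).1 => xA.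
  by apply: DE; exists s.
have [y [yU Jy]] := ultraFilterLemma JP.
exists y => //; split; first by move=> A FA; apply: Jy; exact: filter_joinl.
apply: ultra_sub_eq; first exact: fprod_ultra.
move=> A yxA; apply: contrapT => /(ultra_setC A zU).1 znA.
have ynA : y [set s | x [set t | (~` A) (op s t)]].
  by apply: Jy; apply: filter_joinr; exists (~` A).
move: yxA; rewrite /fprod /= => yxA; apply: (@filter_not_empty _ y _).
apply: filterS (filterI yxA ynA) => s /= [xA xnA].
apply: (@filter_not_empty _ x _).
by apply: filterS (filterI xA xnA) => t [].
Qed.

(* Closed subsets of the space of ultrafilters on [T] correspond to filters
   [F], through [{p | F `<=` p}]. This says that the closed set of [F] is a
   subsemigroup. *)
Definition subsemigroup F :=
  forall A q, F A -> UltraFilter q -> F `<=` q -> F [set s | q [set t | A (op s t)]].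

(* The closed set of [F] is a left ideal. *)
Definition left_ideal F := forall A s, F A -> F [set t | A (op s t)].

Lemma left_ideal_subsemigroup F : Filter F -> left_ideal F -> subsemigroup F.
Proof.
by move=> FF Fi A q FA qU Fq; apply: filterE => s; apply: Fq; exact: Fi.
Qed.

Lemma left_idealM F p x : left_ideal F -> Filter p -> F `<=` x -> F `<=` p ** x.
Proof. by move=> Fi pF Fx A FA; rewrite /fprod /=; apply: filterE => s; apply: Fx; exact: Fi. Qed.

(* The Ellis-Numakura lemma. In terms of closed sets: a minimal closed
   subsemigroup [M] is equal to [M ** x] for every [x] in [M], and then also to
   the closed subsemigroup of the [y] in [M] with [y ** x = x]. *)
Lemma exists_idempotent F0 : ProperFilter F0 -> subsemigroup F0 ->
  exists2 x, UltraFilter x & F0 `<=` x /\ x ** x = x.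
Proof.
move=> P0 S0; have [C [F1 CF1] Ctot Cgood|M [MP MS sub0 Mmax]] := maximal_filter P0 S0.
  move=> A q [F CF FA] qU Cq; exists F => //; apply: (Cgood _ CF).2 => //.
  by move=> B FB; apply: Cq; exists F.
have [x [xU Mx]] := ultraFilterLemma MP.
have MxM : M ** x = M.
  apply: Mmax; first exact: fprod_proper.
    move=> A q MxA qU Mxq.
    have [y yU [My qyx]] := fprod_lift MP xU qU Mxq.
    rewrite qyx /fprod /=; set B := [set s | x [set t | A (op s t)]] in MxA *.
    have MD : M [set s | y [set t | B (op s t)]] by exact: MS.
    rewrite /fprod /=; apply: filterS (MS _ x MD xU Mx) => s.
    rewrite /B /=; apply: filterS => t; apply: filterS => u /=.
    by apply: filterS => v /=; rewrite -!opA.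
  by move=> A MA; exact: MS.
have [|y yU [My xyx]] := fprod_lift MP xU xU; first by rewrite MxM.
pose G := traces x x.
have GT : G setT by exact: tracesT.
have Gy : G `<=` y by move=> _ [A xA ->]; move: xA; rewrite {1}xyx.
have JP : ProperFilter (filter_join M G).
  apply: filter_join_proper => //; first exact: tracesI.
  move=> D E /My yD /Gy yE.
  exact: (@filter_ex _ y _ _ (filterI yD yE)).
have JM : filter_join M G = M.
  apply: Mmax => //; last exact: filter_joinl.
  move=> A q [D [_ [MD [E xE ->] DE]]] qU Jq.
  have Mq : M `<=` q by move=> B MB; apply: Jq; exact: filter_joinl.
  have xqx : q ** x = x.
    apply: ultra_sub_eq => //; first exact: fprod_proper.
    move=> B xB; apply: Jq; apply: filter_joinr.
    by exists B.
  exists [set s | q [set t | D (op s t)]], [set s | x [set t | E (op s t)]]; split.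
  - exact: MS.
  - by exists E.
  - move=> s [/= qD]; rewrite -{1}xqx => qE.
    apply: filterS (filterI qD qE) => t [Dst Est]; apply: DE; split=> //=.
    by apply: filterS Est => u /=; rewrite opA.
(* By [JM], [M] contains [traces x x], and so does [x]. *)
exists x => //; split; first exact: subset_trans Mx.
apply: ultra_sub_eq => //; first exact: fprod_proper.
move=> A xA; apply: Mx; rewrite -JM; apply: filter_joinr; by exists A.
Qed.

(** Inclusion of filters reverses inclusion of closed sets: a minimal ideal is a maximal filter. *)
Definition minimal_left_ideal F := [/\ ProperFilter F, left_ideal F &
  forall G, ProperFilter G -> left_ideal G -> F `<=` G -> G = F].

Lemma exists_minimal_left_ideal F0 : ProperFilter F0 -> left_ideal F0 ->
  exists2 M, minimal_left_ideal M & F0 `<=` M.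
Proof.
move=> P0 S0; have [C [F1 CF1] Ctot Cgood|M [MP MS sub0 Mmax]] := maximal_filter P0 S0.
  by move=> A s [F CF FA]; exists F => //; apply: (Cgood _ CF).2.
by exists M.
Qed.

(** [M ** x] is a left ideal inside that of [M], hence equal to it. *)
Lemma minimal_left_ideal_div M x z : minimal_left_ideal M ->
  UltraFilter x -> UltraFilter z -> M `<=` x -> M `<=` z ->
  exists2 y, UltraFilter y & M `<=` y /\ z = y ** x.
Proof.
move=> [MP Mi Mmax] xU zU Mx Mz; apply: fprod_lift => //.
rewrite (_ : M ** x = M) //; apply: Mmax.
- exact: fprod_proper.
- move=> A s MxA; rewrite /fprod /=; apply: filterS (Mi _ s MxA) => t /=.
  by apply: filterS => u /=; rewrite opA.
- exact: left_idealM.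
Qed.

End filter_semigroup.

Lemma fmap_fprod T U (op : T -> T -> T) (op' : U -> U -> U) (h : T -> U)
    (p q : set_system T) : {morph h : s t / op s t >-> op' s t} ->
  fmap h (fprod op p q) = fprod op' (fmap h p) (fmap h q).
Proof.
move=> hM; apply/funext => A; rewrite /fmap /fprod /=; congr p.
by apply/funext => s; congr q; apply/funext => t /=; rewrite hM.
Qed.

Lemma fmap_comp T U V (f : T -> U) (g : U -> V) (p : set_system T) :
  fmap g (fmap f p) = fmap (g \o f) p.
Proof. by []. Qed.

(** * Variable words *)

Section variable_words.
Context (A : Type).

(* In a word over [option A], the letter [None] is the variable. *)
Definition subst (a : option A) : seq (option A) -> seq (option A) :=
  map (fun o => if o is Some _ then o else a).

Lemma subst_None w : subst None w = w.
Proof. by elim: w => //= -[b|] w IH; rewrite /subst /= -/(subst None w) IH. Qed.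

Definition ends_in_variable : set (seq (option A)) :=
  [set w | exists u, w = rcons u None].

Local Notation "p ** q" := (fprod cat p q) (at level 40, left associativity).

(* Take an idempotent [q] in a minimal left ideal of the ultrafilters on
   constant words, and an idempotent [p] with [q ** p = p] in a minimal left
   ideal that concentrates on words ending in the variable. The idempotent
   [f = subst a p] satisfies [q ** f = f], hence [f ** q = q] as [q] is minimal,
   and [f ** p = f ** q ** p = q ** p = p]. *)
Lemma variable_word_ultrafilter : exists p : set_system (seq (option A)),
  [/\ UltraFilter p, p ends_in_variable &
      forall a, fmap (subst a) p ** p = p].
Proof.
have catA' X : associative (@cat X) by exact: catA.
have [|M0 M0min _] := @exists_minimal_left_ideal _ (@cat A) (globally setT)
  (globally_properfilter (I : setT [::])); first by move=> B s /= BT t _; exact: BT.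
have [M0P M0i _] := M0min.
have [q qU [M0q qq]] := exists_idempotent (catA' _) M0P
  (left_ideal_subsemigroup _ M0i).
have [||M Mmin VM] := @exists_minimal_left_ideal _ (@cat (option A))
  (globally ends_in_variable).
- by apply: (@globally_properfilter _ _ [:: None]); exists [::].
- move=> B s /= BV _ [u ->]; apply: BV; exists (s ++ u).
  by rewrite -rcons_cat.
have [MP Mi _] := Mmin.
have [p' p'U [Mp' p'p']] := exists_idempotent (catA' _) MP
  (left_ideal_subsemigroup _ Mi).
pose q' := fmap (map (@Some A)) q.
have q'U : UltraFilter q' by exact: ultra_fmap.
have Some_cat : {morph map (@Some A) : v w / v ++ w} by move=> v w; rewrite map_cat.
have q'q' : q' ** q' = q' by rewrite /q' -(fmap_fprod _ _ Some_cat) qq.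
have xU : UltraFilter (q' ** p') by exact: fprod_ultra.
have Mx : M `<=` q' ** p' by apply: left_idealM.
have [y0 y0U [My0 p'y0]] := minimal_left_ideal_div (catA' _) Mmin xU p'U Mx Mp'.
(* [x] itself need not be idempotent. Dividing [p'] by [x] gives [y ** x = p'] and [p' ** y = y], so
   [x ** y ** x ** y = x ** p' ** y = x ** y]. *)
pose x := q' ** p'; pose y := p' ** y0; pose p := x ** y.
have q'p : q' ** p = p by rewrite /p /x -!(fprodA (catA' _)) q'q'.
have yx : y ** x = p' by rewrite /y (fprodA (catA' _)) -p'y0.
have p'y : p' ** y = y by rewrite /y -(fprodA (catA' _)) p'p'.
have pp : p ** p = p.
  by rewrite /p (fprodA (catA' _)) -(fprodA (catA' _) y x y) yx p'y.
have pU : UltraFilter p by apply: fprod_ultra => //; exact: fprod_ultra.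
have My : M `<=` y by exact: left_idealM.
have Mp : M `<=` p by exact: left_idealM.
exists p; split=> //; first exact/Mp/VM.
case=> [a|]; last first.
  rewrite (_ : fmap (subst None) p = p) //.
  by apply/funext => B /=; congr p; apply/funext => w /=; rewrite subst_None.
pose h := map (odflt a).
have h_cat : {morph h : v w / v ++ w} by move=> v w; rewrite /h map_cat.
have hSome : fmap h q' = q.
  rewrite /q' fmap_comp; apply/funext => B /=; congr q; apply/funext => w /=.
  by rewrite /h -map_comp map_id.
pose f := fmap h p.
have fU : UltraFilter f by exact: ultra_fmap.
have ff : fprod cat f f = f by rewrite /f -(fmap_fprod _ _ h_cat) pp.
have qf : fprod cat q f = f by rewrite /f -{1}hSome -(fmap_fprod _ _ h_cat) q'p.
(* Since [q ** f = f], the product [e = f ** q] is idempotent and [q ** e = e]. By minimality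
   [q = z ** e], so also [q ** e = q]. *)
have fq : fprod cat f q = q.
  have eU : UltraFilter (fprod cat f q) by exact: fprod_ultra.
  have M0e : M0 `<=` fprod cat f q by exact: left_idealM.
  have [z zU [_ qze]] := minimal_left_ideal_div (catA' _) M0min eU qU M0e M0q.
  have ee : fprod cat (fprod cat f q) (fprod cat f q) = fprod cat f q.
    by rewrite !(fprodA (catA' _)) -(fprodA (catA' _) q f q) qf -(fprodA (catA' _) f f q) ff.
  transitivity (fprod cat q (fprod cat f q)).
    by rewrite -(fprodA (catA' _)) qf.
  by rewrite {1}qze (fprodA (catA' _)) ee.
have -> : fmap (subst (Some a)) p = fmap (map (@Some A)) f.
  rewrite /f fmap_comp; apply/funext => B /=; congr p; apply/funext => w /=.
  by rewrite /h -map_comp; congr B; apply: eq_map; case.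
by rewrite -{1}q'p -(fprodA (catA' _)) -(fmap_fprod _ _ Some_cat) fq.
Qed.

End variable_words.

Lemma ultra_finite_color (C : finType) T (p : set_system T) (f : T -> C) :
  UltraFilter p -> exists m, p (f @^-1` [set m]).
Proof.
move=> pU; apply: contrapT => nm.
have : p [set t | forall m, f t <> m].
  apply: (@filter_forall _ _ (fun m t => f t <> m)) => m.
  case: (in_ultra_setVsetC (f @^-1` [set m]) pU) => // pm.
  by case: nm; exists m.
by move=> /(@filter_ex _ p _) [t /(_ (f t))].
Qed.

Section variable_word_ramsey.
Context (A : finType).

(* A form of Carlson's theorem. *)
Lemma variable_word_ramsey (C : finType) (chi : seq (option A) -> C) :
  exists m (X : nat -> seq (option A)), (forall i, ends_in_variable (X i)) /\
    forall n (a : nat -> option A),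
      chi (flatten (mkseq (fun i => subst (a i) (X i)) n) ++ X n) = m.
Proof.
have [p [pU pV pT]] := variable_word_ultrafilter A.
have [m pm] := ultra_finite_color chi pU.
pose step (G : set (seq (option A))) w :=
  [set v | forall a, G (subst a w ++ v)].
have stepP G : p G -> exists w, [/\ ends_in_variable w, G w & p (step G w)].
  (* For each of the finitely many [a], this is [G] being large for [fmap (subst a) p ** p = p]. *)
  move=> pG; have : p [set w | forall a, p [set v | G (subst a w ++ v)]].
    apply: (@filter_forall _ _ (fun a w => p [set v | G (subst a w ++ v)])) => a.
    by move: pG; rewrite -{1}(pT a).
  move=> /(filterI (filterI pV pG)) /(@filter_ex _ p _) [w [[wV Gw] wG]].
  by exists w; split=> //; exact: (@filter_forall _ _ (fun a v => G (subst a w ++ v))).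
pose sG := {G | p G}.
pose word (G : sG) := sval (cid (stepP _ (svalP G))).
have wordP G := svalP (cid (stepP _ (svalP G))) :
  [/\ ends_in_variable (word G), sval G (word G) & p (step (sval G) (word G))].
pose next (G : sG) : sG := let: And3 _ _ h := wordP G in exist _ _ h.
pose G0 : sG := exist _ _ pm.
pose G n := iter n next G0.
pose X n := word (G n).
have GS n : sval (G n.+1) = step (sval (G n)) (X n).
  by rewrite /G iterS /next; case: (wordP _).
exists m, X; split=> [i|n a]; first by case: (wordP (G i)).
(* Members of [G n] may follow any instances of [X 0], ..., [X (n - 1)]. *)
suff : forall n v, sval (G n) v ->
    sval G0 (flatten (mkseq (fun i => subst (a i) (X i)) n) ++ v).
  by move=> /(_ n (X n)); apply; case: (wordP (G n)).
elim=> [|{}n IH] v //; rewrite GS => /(_ (a n)) /IH.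
by rewrite mkseqS flatten_rcons -catA.
Qed.

End variable_word_ramsey.

(** * Connections as pairs of functions on the natural numbers *)

Definition pairing := ((nat -> nat) * (nat -> nat))%type.

(* The part of the definition of [connections] that concerns the first [K]
   values of the increasing map. Only the values of [x.1] up to
   [x.2 K.-1] matter. *)
Definition connects K (x : pairing) :=
  [/\ (forall a b, a < b -> b < K -> x.2 a < x.2 b)%N,
      (forall a, (a < K)%N -> x.1 (x.2 a) = a) &
      (forall a y, a < K -> y <= x.2 a -> x.1 y <= a)%N].

Definition connection (e : pairing) := forall K, connects K e.

Definition pcomp (x e : pairing) : pairing := (x.1 \o e.1, e.2 \o x.2).

Definition idp : pairing := (id, id).

Lemma compA x d e : pcomp x (pcomp d e) = pcomp (pcomp x d) e.
Proof. by []. Qed.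

Lemma comp_idp e : pcomp idp e = e.
Proof. by case: e. Qed.

(** Then [pcomp d e] has the same first [n] marks as [e], and the same values wherever [e.1] is
    below [n]. This makes infinite compositions converge. *)
Definition fixes n (d : pairing) :=
  forall y, (y < n)%N -> d.1 y = y /\ d.2 y = y.

Lemma connection_incr e : connection e -> {mono e.2 : a b / (a < b)%N}.
Proof.
move=> eE; apply: leqW_mono; apply: leq_mono => a b ab.
by have [+ _ _] := eE b.+1; apply.
Qed.

Lemma connection_cancel e : connection e -> cancel e.2 e.1.
Proof. by move=> eE a; have [_ + _] := eE a.+1; apply. Qed.

Lemma connection_bound e a y : connection e -> (y <= e.2 a)%N -> (e.1 y <= a)%N.
Proof. by move=> eE; have [_ _ +] := eE a.+1; apply. Qed.

Lemma connection_ge e a : connection e -> (a <= e.2 a)%N.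
Proof.
move=> eE; elim: a => // a; move=> /leq_ltn_trans; apply.
by rewrite connection_incr.
Qed.

Lemma connection_le e y : connection e -> (e.1 y <= y)%N.
Proof. by move=> eE; apply: connection_bound => //; exact: connection_ge. Qed.

Lemma connectionP e : {homo e.2 : a b / (a < b)%N} -> cancel e.2 e.1 ->
  (forall a y, (y <= e.2 a)%N -> (e.1 y <= a)%N) -> connection e.
Proof. by move=> h1 h2 h3 K; split=> // [a b /h1 //|a y _ /h3]. Qed.

Lemma connection_idp : connection idp.
Proof. exact: connectionP. Qed.

Lemma connects_comp K x e : connects K x -> connection e -> connects K (pcomp x e).
Proof.
move=> [x1 x2 x3] eE; split=> [a b ab bK|a aK|a y aK ya] /=.
- by rewrite connection_incr //; exact: x1.
- by rewrite connection_cancel // x2.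
- by apply: x3 => //; exact: connection_bound.
Qed.

Lemma connection_comp d e : connection d -> connection e -> connection (pcomp d e).
Proof. by move=> dE eE K; exact: connects_comp. Qed.

Lemma fixes_comp n d e : fixes n d -> fixes n e -> fixes n (pcomp d e).
Proof.
move=> df ef y yn; have [d1 d2] := df y yn; have [e1 e2] := ef y yn.
by rewrite /= e1 d1 d2 e2.
Qed.

Lemma fixes_le m n d : (m <= n)%N -> fixes n d -> fixes m d.
Proof. by move=> mn df y ym; apply: df; exact: leq_trans mn. Qed.

(** * Infinite compositions and fusion *)

Section limit.
Context (d : nat -> pairing).
Hypothesis dE : forall n, connection (d n).
Hypothesis d_fixes : forall n, fixes n (d n).

(** [g n k] is the composition of [d n], ..., [d (n + k - 1)], and [f n] is its limit: the values at
    [y] are constant once [k] exceeds [y]. *)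
Let g n := fix g k := if k is k'.+1 then pcomp (d (n + k')) (g k') else idp.
Let f n : pairing := (fun y => (g n y.+1).1 y, fun y => (g n y.+1).2 y).

Let gE n k : connection (g n k).
Proof. by elim: k => [|k IH]; [exact: connection_idp|exact: connection_comp]. Qed.

Let g_fixes n k : fixes n (g n k).
Proof.
elim: k => [|k IH] //; apply: fixes_comp => //.
by apply: fixes_le (@d_fixes (n + k)); rewrite leq_addr.
Qed.

Let g_stable n k y : (y < k)%N -> (g n k).1 y = (f n).1 y /\ (g n k).2 y = (f n).2 y.
Proof.
elim: k => // k IH; rewrite ltnS leq_eqVlt => /orP[/eqP -> //|yk].
have [<- <-] := IH yk; split=> /=.
  apply: (@d_fixes (n + k) _ _).1; apply: leq_ltn_trans (connection_le _ (gE _ _)) _; lia.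
congr ((g n k).2 _); apply: (@d_fixes (n + k) y _).2; lia.
Qed.

Let g_cat n k : g 0 (n + k) = pcomp (g n k) (g 0 n).
Proof. by elim: k => [|k IH]; rewrite ?addn0 ?comp_idp // addnS /= IH. Qed.

Lemma pairing_limit (e : nat -> pairing) :
    e 0 = idp -> (forall n, e n.+1 = pcomp (d n) (e n)) ->
  exists f0, connection f0 /\
    forall n, exists fn, [/\ connection fn, fixes n fn & f0 = pcomp fn (e n)].
Proof.
move=> e0 eS.
have eg n : e n = g 0 n by elim: n => // n IH; rewrite eS IH.
have fE n : connection (f n).
  apply: connectionP => [a b ab|a|a y ya].
  - have [_ <-] := @g_stable n b.+1 a (ltnW ab); rewrite [ltnRHS]/=.
    by rewrite connection_incr.
  (* A finite stage beyond both points at which the limit is evaluated. *)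
  - have [_ fa] := @g_stable n (maxn a ((f n).2 a)).+1 a (ltac:(lia)).
    have [<- _] := @g_stable n (maxn a ((f n).2 a)).+1 ((f n).2 a) (ltac:(lia)).
    by rewrite -{2}fa connection_cancel.
  - have [_ fa] := @g_stable n (maxn a y).+1 a (ltac:(lia)).
    have [<- _] := @g_stable n (maxn a y).+1 y (ltac:(lia)).
    by apply: connection_bound => //; rewrite fa.
exists (f 0); split=> // n; exists (f n); split=> //.
  by move=> y yn; exact: g_fixes.
have f1 y : (f 0).1 y = (f n).1 ((g 0 n).1 y).
  have [<- _] := @g_stable 0 (n + (maxn y ((g 0 n).1 y)).+1) y (ltac:(lia)).
  rewrite g_cat [LHS]/=.
  by have [<- _] := @g_stable n (maxn y ((g 0 n).1 y)).+1 ((g 0 n).1 y) (ltac:(lia)).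
have f2 y : (f 0).2 y = (g 0 n).2 ((f n).2 y).
  have [_ <-] := @g_stable 0 (n + y.+1) y (ltac:(lia)).
  by rewrite g_cat.
by rewrite eg; congr pair; apply/funext; [exact: f1|exact: f2].
Qed.

End limit.

(** Stage [n] meets the requirements listed in [L n] one by one, by connections that fix [n]; all
    later factors fix [n] as well and preserve them. [Q n] is an invariant of the finite stages
    only, not claimed of the limit. *)
Lemma fusion (X : eqType) (L : nat -> seq X) (P : nat -> X -> pairing -> Prop)
    (Q : nat -> pairing -> Prop) :
    Q 0 idp -> (forall n e, Q n e -> Q n.+1 e) ->
    (forall n p e d, connection d -> fixes n d -> P n p e -> P n p (pcomp d e)) ->
    (forall n p e, connection e -> Q n e -> exists d,
      [/\ connection d, fixes n d, Q n (pcomp d e) & P n p (pcomp d e)]) ->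
  exists2 e, connection e & forall n p, p \in L n -> P n p e.
Proof.
move=> Q0 QS Pstable Pex.
have Lex n e : connection e -> Q n e -> exists d,
    [/\ connection d, fixes n d, Q n (pcomp d e) &
      forall p, p \in L n -> P n p (pcomp d e)].
  move=> eE Qe; elim: (L n) => [|p ps [d [dE df Qd Pd]]].
    by exists idp; rewrite comp_idp; split=> //; exact: connection_idp.
  have [d' [d'E d'f Qd' Pd']] := Pex n p _ (connection_comp dE eE) Qd.
  exists (pcomp d' d); split=> //; [exact: connection_comp|exact: fixes_comp|].
  move=> p'; rewrite inE => /orP[/eqP -> //|/Pd]; exact: Pstable.
have /choice[D DP] : forall ne : nat * pairing, exists d,
    connection ne.2 -> Q ne.1 ne.2 ->
    [/\ connection d, fixes ne.1 d, Q ne.1 (pcomp d ne.2) &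
      forall p, p \in L ne.1 -> P ne.1 p (pcomp d ne.2)].
  move=> [n e] /=.
  have [[eE Qe]|neQ] := pselect (connection e /\ Q n e).
    by have [d dP] := Lex n e eE Qe; exists d.
  by exists idp => eE Qe; case: neQ.
pose e := fix e n := if n is n'.+1 then pcomp (D (n', e n')) (e n') else idp.
have eP n : connection (e n) /\ Q n (e n).
  elim: n => [|n [eE Qe]]; first by split=> //; exact: connection_idp.
  have [dE _ Qd _] := DP (n, e n) eE Qe; split; last exact: QS.
  exact: connection_comp.
have [||f0 [f0E f0P]] := @pairing_limit (fun n => D (n, e n)) _ _ e erefl (fun n => erefl).
- by move=> n; have [eE Qe] := eP n; have [] := DP (n, e n) eE Qe.
- by move=> n; have [eE Qe] := eP n; have [] := DP (n, e n) eE Qe.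
exists f0 => // n p pL; have [fn [fnE fnf ->]] := f0P n.+1.
apply: Pstable => //; first exact: (fixes_le (leqnSn n)).
by have [eE Qe] := eP n; have [_ _ _] := DP (n, e n) eE Qe; exact.
Qed.

(** * Connections made of blocks *)

Section blocks.
Context (n : nat) (g : nat -> seq nat).
Hypothesis g_block : forall k, exists2 u, g k = rcons u (n + k)%N & all (leq^~ (n + k)%N) u.

Let prefix_size k := size (flatten (mkseq g k)).

(* The infinite concatenation of the words [g 0], [g 1], ..., preceded by
   [0, ..., n.-1]. The marks are the last positions of the words. *)
Definition block_pairing : pairing :=
  (fun y => if (y < n)%N then y else nth 0 (flatten (mkseq g (y - n).+1)) (y - n),
   fun y => if (y < n)%N then y else (n + prefix_size (y - n).+1).-1).

Let prefix_sizeS k : prefix_size k.+1 = (prefix_size k + size (g k))%N.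
Proof. by rewrite /prefix_size mkseqS flatten_rcons size_cat. Qed.

Let size_g k : (0 < size (g k))%N.
Proof. by have [u -> _] := g_block k; rewrite size_rcons. Qed.

Let prefix_size_le k m : (k <= m)%N -> (prefix_size k <= prefix_size m)%N.
Proof.
move/subnK <-; elim: (m - k)%N => // i IH.
by rewrite addSn prefix_sizeS (leq_trans IH) // leq_addr.
Qed.

Let prefix_size_ge k : (k <= prefix_size k)%N.
Proof.
elim: k => // k IH; rewrite prefix_sizeS; have := size_g k; lia.
Qed.

Let nth_prefix k m b : (k <= m)%N -> (b < prefix_size k)%N ->
  nth 0 (flatten (mkseq g m)) b = nth 0 (flatten (mkseq g k)) b.
Proof.
move/subnK <-; elim: (m - k)%N => // i IH bk.
rewrite addSn mkseqS flatten_rcons nth_cat -/(prefix_size _) IH //.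
by rewrite (leq_trans bk) // prefix_size_le // leq_addl.
Qed.

(** The definition reads [y] in the first [y - n + 1] words, enough because no word is empty. Any
    other number of words that reaches the position gives the same letter. *)
Lemma block_pairing_nth N y : (n <= y)%N -> (y - n < size (flatten (mkseq g N)))%N ->
  block_pairing.1 y = nth 0 (flatten (mkseq g N)) (y - n).
Proof.
move=> ny yN /=; rewrite ltnNge ny /=.
case: (leqP N (y - n).+1) => [le|/ltnW le]; first by rewrite (nth_prefix le).
by rewrite (nth_prefix le) // prefix_size_ge.
Qed.

Lemma block_pairing_fixes : fixes n block_pairing.
Proof. by move=> y yn /=; rewrite yn. Qed.

Lemma block_pairing_connection : connection block_pairing.
Proof.
apply: connectionP => [a b ab|a|a y].
- rewrite /=; case: (ltnP a n) => an; case: (ltnP b n) => bn; try lia.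
    have := prefix_size_ge (b - n).+1; lia.
  have -> : (b - n).+1 = ((a - n).+1 + (b - a))%N by lia.
  have := @prefix_size_le (a - n).+2 ((a - n).+1 + (b - a)) (ltac:(lia)).
  have := size_g (a - n).+1; rewrite (prefix_sizeS (a - n).+1).
  have := prefix_size_ge (a - n).+1; lia.
- case: (ltnP a n) => an; first by rewrite /= an an.
  have sz := prefix_size_ge (a - n).+1.
  rewrite {2}/block_pairing [X in _.1 X]/= ltnNge an /=.
  have -> : (n + prefix_size (a - n).+1).-1 = (n + (prefix_size (a - n).+1).-1)%N by lia.
  rewrite -[LHS]/(block_pairing.1 _) (@block_pairing_nth (a - n).+1); last 2 first.
  + exact: leq_addr.
  + by rewrite addKn -/(prefix_size _) prednK //; lia.
  rewrite addKn nth_last mkseqS flatten_rcons last_cat.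
  by have [u -> _] := g_block (a - n); rewrite last_rcons; lia.
- rewrite [X in (_ <= X)%N]/=; case: (ltnP a n) => an ya.
    by rewrite /= (leq_ltn_trans ya an).
  case: (ltnP y n) => yn; first by rewrite /= yn; lia.
  have sz := prefix_size_ge (a - n).+1.
  have yN : (y - n < prefix_size (a - n).+1)%N by lia.
  rewrite (block_pairing_nth yn yN).
  have /flattenP[_ /mapP[i + ->]] := mem_nth 0 yN.
  rewrite mem_iota => /andP[_ ia].
  have [u -> /allP/= uP] := g_block i.
  rewrite mem_rcons inE => /orP[/eqP ->|/uP]; lia.
Qed.

Lemma block_pairing_mark y : (n <= y)%N ->
  block_pairing.2 y = (n + size (flatten (mkseq g (y - n).+1))).-1.
Proof. by move=> ny; rewrite /= ltnNge ny. Qed.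

End blocks.

(** * The part up to the last mark *)

Definition agree_to_mark K (x x' : pairing) :=
  forall a, (a < K)%N -> x.2 a = x'.2 a /\ forall y, (y <= x.2 a)%N -> x.1 y = x'.1 y.

Lemma agree_to_mark_sym K x x' : agree_to_mark K x x' -> agree_to_mark K x' x.
Proof. by move=> xx a /xx[-> xy]; split=> // y ya; rewrite xy. Qed.

Lemma agree_to_mark_trans K x y z :
  agree_to_mark K x y -> agree_to_mark K y z -> agree_to_mark K x z.
Proof.
move=> xy yz a aK; have [xya xy1] := xy a aK; have [yza yz1] := yz a aK.
by rewrite xya yza; split=> // b ba; rewrite xy1 ?yz1 // ?xya ?yza.
Qed.

Lemma agree_to_mark_comp K x x' e : connection e ->
  agree_to_mark K x x' -> agree_to_mark K (pcomp x e) (pcomp x' e).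
Proof.
move=> eE xx a /xx[/= -> xy]; split=> // y ya; apply: xy.
exact: connection_bound.
Qed.

Definition mark_length K (x : pairing) := if K is K'.+1 then (x.2 K').+1 else 0.

Lemma connects_leq K x a b : connects K x -> (a <= b)%N -> (b < K)%N -> (x.2 a <= x.2 b)%N.
Proof.
move=> [h _ _]; rewrite leq_eqVlt => /orP[/eqP -> //|ab] bK.
exact/ltnW/h.
Qed.

Lemma mark_lengthP K x a : connects K x -> (a < K)%N -> (x.2 a < mark_length K x)%N.
Proof.
case: K => // K xK; rewrite ltnS => aK /=; rewrite ltnS.
exact: (connects_leq xK).
Qed.

Lemma connectsW K x : connects K.+1 x -> connects K x.
Proof.
move=> [x1 x2 x3]; split=> [a b ab bK|a aK|a y aK].
- exact/x1/ltnW.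
- exact/x2/ltnW.
- exact/x3/ltnW.
Qed.

Fixpoint bounded_seqs m b : seq (seq nat) :=
  if m is m'.+1 then [seq c :: t | c <- iota 0 b, t <- bounded_seqs m' b] else [:: [::]].

Lemma mem_bounded_seqs m b t : size t = m -> all (ltn^~ b) t -> t \in bounded_seqs m b.
Proof.
elim: t m => [|c t IH] [|m] //= [/IH mt] /andP[cb /mt tm].
by apply: allpairs_f => //; rewrite mem_iota.
Qed.

(** A code for a basic open set, in an [eqType] so that a fusion can list the finitely many codes of
    a stage. *)
Definition start K n (x : pairing) := (mkseq x.1 n, mkseq x.2 K).

Definition starts K n := [seq (t, i) | t <- bounded_seqs n K, i <- bounded_seqs K n].

Lemma mem_starts K n x : (forall y, (y < n)%N -> (x.1 y < K)%N) ->
  (forall a, (a < K)%N -> (x.2 a < n)%N) -> start K n x \in starts K n.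
Proof.
move=> x1 x2; apply: allpairs_f; apply: mem_bounded_seqs; rewrite ?size_mkseq //.
- by apply/allP => _ /mapP[y + ->]; rewrite mem_iota => /x1.
- by apply/allP => _ /mapP[y + ->]; rewrite mem_iota => /x2.
Qed.

Lemma startP K n x x' : start K n x = start K n x' <->
  (forall y, (y < n)%N -> x.1 y = x'.1 y) /\ (forall a, (a < K)%N -> x.2 a = x'.2 a).
Proof.
split=> [[e1 e2]|[e1 e2]].
  split=> y yn.
    by rewrite -(nth_mkseq 0 x.1 yn) e1 nth_mkseq.
  by rewrite -(nth_mkseq 0 x.2 yn) e2 nth_mkseq.
congr pair; apply/eq_in_map => y; rewrite mem_iota; [exact: e1|exact: e2].
Qed.

Lemma start_comp K n x d : fixes n d -> (forall a, (a < K)%N -> (x.2 a < n)%N) ->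
  start K n (pcomp x d) = start K n x.
Proof.
move=> dn x2; apply/startP; split=> y yn /=.
  by rewrite (dn _ yn).1.
by rewrite (dn _ (x2 _ yn)).2.
Qed.

(** * Colorings that depend on a finite part *)

Section one_more_mark.
Context (K n : nat) (x0 : pairing).
Hypothesis (x0K : connects K x0) (x0n : mark_length K x0 = n).

(* The letter [Some a] stands for [a], and the variable for [K]. *)
Let letter (o : option 'I_K) : nat := if o is Some a then val a else K.

Let extend (w : seq (option 'I_K)) : pairing :=
  (fun y => if (y < n)%N then x0.1 y else nth K (map letter w) (y - n),
   fun a => if (a < K)%N then x0.2 a else (n + size w).-1).

(** Color a word [w] by the color of [extend w] composed with [e], and let the blocks of [d] be the
    resulting variable words. If [x] extends the given part and its mark of [K] is at [n + N], then
    up to its mark of [K] the composition of [x] with [d] is that part followed by instances of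
    [X 0], ..., [X (N - 1)] and by [X N] unsubstituted. *)
Lemma one_more_mark_ramsey (C : finType) (chi : pairing -> C) e :
  (forall x x', connects K.+1 x -> agree_to_mark K.+1 x x' -> chi x = chi x') ->
  connection e ->
  exists d, [/\ connection d, fixes n d & exists m, forall x, connects K.+1 x ->
    mark_length K x = n -> start K n x = start K n x0 -> chi (pcomp x (pcomp d e)) = m].
Proof.
move=> chiP eE.
have [m [X [XV Xm]]] := variable_word_ramsey (fun w => chi (pcomp (extend w) e)).
have x0lt a : (a < K)%N -> (x0.2 a < n)%N by rewrite -x0n; exact: mark_lengthP.
(* A constant [a] becomes the position of its mark, which every [x] considered maps back to [a]; the
   variable becomes the new letter [n + k], to be replaced by [x.1 (n + k)]. *)
pose image k (o : option 'I_K) := if o is Some a then x0.2 a else (n + k)%N.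
pose g k := map (image k) (X k).
have g_block k : exists2 u, g k = rcons u (n + k)%N & all (leq^~ (n + k)%N) u.
  have [u Xu] := XV k; exists (map (image k) u); first by rewrite /g Xu map_rcons.
  rewrite all_map; apply/allP => -[a|] _ /=; last by [].
  by have := x0lt a (ltn_ord a); lia.
exists (block_pairing n g); split.
- exact: block_pairing_connection.
- exact: block_pairing_fixes.
exists m => x xK xn /startP[x_s x_j].
have [x1 x2 x3] := xK.
have nK : (n <= x.2 K)%N.
  by rewrite -xn /mark_length; case: (K) x1 => // K' x1; exact: x1.
pose N := (x.2 K - n)%N.
(* [insub] gives [None] from [K] on; up to the mark of [K] the only such value is [K]. *)
pose a i : option 'I_K := insub (x.1 (n + i)%N).
have aP i : (i <= N)%N -> letter (a i) = x.1 (n + i)%N.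
  move=> iN; rewrite /a; case: insubP => [b _ //|] /=; rewrite -leqNgt => Kx.
  by apply/eqP; rewrite eqn_leq Kx x3 //; rewrite /N in iN; lia.
have aN : a N = None by rewrite /a /N subnKC // x2 // insubF // ltnn.
pose w := flatten (mkseq (fun i => subst (a i) (X i)) N.+1).
rewrite compA; apply: etrans (Xm N a); rewrite (_ : _ ++ _ = w); last first.
  by rewrite /w mkseqS flatten_rcons aN subst_None.
apply: chiP; first by do 2! apply: connects_comp => //; exact: block_pairing_connection.
apply: agree_to_mark_comp => //.
have gw : map x.1 (flatten (mkseq g N.+1)) = map letter w.
  rewrite !map_flatten -!map_comp; congr flatten; apply/eq_in_map => i.
  rewrite mem_iota ltnS => iN /=; rewrite /g /subst -!map_comp; apply: eq_map.
  case=> [b|] /=; last by rewrite aP.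
  by rewrite x_s ?x0lt //; have [_ -> //] := x0K.
have size_w : size w = size (flatten (mkseq g N.+1)).
  by rewrite -(size_map letter) -gw size_map.
have Bfix := @block_pairing_fixes n g.
have Bmark := @block_pairing_mark n g.
have Bnth := block_pairing_nth g_block.
move: (block_pairing n g) Bfix Bmark Bnth => B Bfix Bmark Bnth b bK1.
have [bK|bK] := ltnP b K.
  have bn : (x.2 b < n)%N by rewrite x_j // x0lt.
  rewrite /= bK (Bfix _ bn).2; split=> [|y yb]; first exact: x_j.
  have yn := leq_ltn_trans yb bn.
  by rewrite yn (Bfix _ yn).1 x_s.
have -> : b = K by lia.
rewrite /= ltnn (Bmark _ nK) -/N -size_w; split=> // y yw.
case: ltnP => yn; first by rewrite (Bfix _ yn).1 x_s.
have ys : (y - n < size w)%N.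
  suff : (0 < size w)%N by lia.
  rewrite /w mkseqS flatten_rcons size_cat aN subst_None.
  by have [u ->] := XV N; rewrite size_rcons; lia.
rewrite (Bnth N.+1) -?size_w // -gw.
by rewrite -(nth_map _ K) // -size_w.
Qed.

End one_more_mark.

Lemma agree_to_markP K x x' : connects K x ->
  agree_to_mark K x x' <->
  mark_length K x = mark_length K x' /\ start K (mark_length K x) x = start K (mark_length K x') x'.
Proof.
move=> xK; split=> [xx|[<-]].
  have xx' : mark_length K x = mark_length K x'.
    by case: K xK xx => // K xK xx /=; rewrite (xx K _).1.
  split=> //; rewrite -xx'; apply/startP; split=> [y|a /xx[]//].
  by case: K xK xx {xx'} => //= K xK xx; rewrite ltnS => /(xx K (ltnSn K)).2.
move/startP => [e1 e2] a aK; split=> [|y ya]; first exact: e2.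
apply: e1; apply: leq_ltn_trans ya _; exact: mark_lengthP.
Qed.

(** Stage [n] of the fusion treats the finitely many parts of length [n] up to the mark of [K - 1],
    and makes the color constant on the extensions of each. *)
Lemma restrict_to_mark (C : finType) K (chi : pairing -> C) :
  (forall x x', connects K.+1 x -> agree_to_mark K.+1 x x' -> chi x = chi x') ->
  exists2 e, connection e & forall x x', connects K.+1 x -> connects K.+1 x' ->
    agree_to_mark K x x' -> chi (pcomp x e) = chi (pcomp x' e).
Proof.
move=> chiP.
pose P n p e := exists m, forall x, connects K.+1 x -> mark_length K x = n ->
  start K n x = p -> chi (pcomp x e) = m.
have [//|//| | |e eE eP] := @fusion _ (starts K) P (fun _ _ => True).
- move=> n p e d dE dn [m em]; exists m => x xK xn xp.
  have x2 a : (a < K)%N -> (x.2 a < n)%N.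
    by rewrite -xn; apply: mark_lengthP; exact: connectsW.
  rewrite compA; apply: em.
  + exact: connects_comp.
  + move: xn x2; rewrite /mark_length; case: (K) => //= K' xn _; move: dn; rewrite -xn => dn.
    by rewrite (dn _ (ltnSn _)).2.
  + by rewrite start_comp.
- move=> n p e eE _.
  have [[x0 [x0K x0n x0p]]|nx] := pselect (exists x0,
      [/\ connects K x0, mark_length K x0 = n & start K n x0 = p]).
    have [d [dE df [m dm]]] := one_more_mark_ramsey x0K x0n chiP eE.
    by exists d; split=> //; exists m => x xK xn xp; apply: dm => //; rewrite xp.
  exists idp; split=> //.
  exists (chi idp) => x xK xn xp; case: nx; exists x; split=> //; exact: connectsW.
exists e => // x x' xK x'K xx'.
have [xn xs] := (agree_to_markP x' (connectsW xK)).1 xx'.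
have [|m me] := eP (mark_length K x) (start K (mark_length K x) x).
  apply: mem_starts => [y|a]; last by apply: mark_lengthP; exact: connectsW.
  case: (K) xK => //= K' [_ _ x3]; rewrite ltnS => /x3; rewrite ltnS; exact.
by rewrite (me x) // (me x') // ?xs xn.
Qed.

Lemma marks_ramsey l K (chi : pairing -> 'I_l) :
  (forall x x', connects K x -> agree_to_mark K x x' -> chi x = chi x') ->
  exists2 e, connection e & exists m, forall x, connects K x -> chi (pcomp x e) = m.
Proof.
elim: K chi => [|K IH] chi chiP.
  exists idp; first exact: connection_idp.
  exists (chi idp) => x xK; apply: chiP => //; exact: connects_comp connection_idp.
have [e eE eP] := restrict_to_mark chiP.
(* By [eP] the color depends only on the part up to the mark of [K - 1], so any extension of that
   part may define the induced coloring [chi']. *)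
pose col x m := exists x', [/\ connects K.+1 x', agree_to_mark K x x' & chi (pcomp x' e) = m].
pose chi' x := xget (chi idp) [set m | col x m].
have chi'E x : connects K.+1 x -> chi' x = chi (pcomp x e).
  move=> xK; apply: xget_subset1; first by exists x; split.
  move=> m m' [y [yK xy <-]] [y' [y'K xy' <-]]; apply: eP => //.
  exact: agree_to_mark_trans (agree_to_mark_sym xy) xy'.
have [x x' _ xx'|e' e'E [m em]] := IH chi'.
  rewrite /chi'; congr xget; apply/seteqP; split=> m [y [yK xy ym]]; exists y; split=> //.
    exact: agree_to_mark_trans (agree_to_mark_sym xx') xy.
  exact: agree_to_mark_trans xy.
exists (pcomp e' e); first exact: connection_comp.
exists m => x xK; rewrite compA -chi'E; last exact: connects_comp.
by apply: em; exact: connectsW.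
Qed.

(** * Borel colorings *)

Section generic.
Context (K : nat).

Definition finite_connection (x : pairing) :=
  connects K x /\ forall y, (x.1 y < K)%N.

Lemma finite_connection_comp x e :
  finite_connection x -> connection e -> finite_connection (pcomp x e).
Proof. by move=> [xK xb] eE; split; [exact: connects_comp|move=> y; exact: xb]. Qed.

(** [Dec i n x] is to say that the basic open set coded by [start K n x] settles question [i]. With
    the bound [n + l] each stage has finitely many questions, the first [l] belong to every stage,
    and every question is eventually reached. *)
Lemma generic_connection l (Dec : nat -> nat -> pairing -> Prop) :
  (forall i n x, finite_connection x -> exists n' x',
    [/\ finite_connection x', (n <= n')%N, start K n x' = start K n x & Dec i n' x']) ->
  exists2 e, connection e & forall i n x, finite_connection x ->
    (forall a, (a < K)%N -> (x.2 a < n)%N) -> (i < n + l)%N ->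
    exists n0 x0, [/\ finite_connection x0, Dec i n0 x0 &
      forall x', finite_connection x' -> start K n x' = start K n x ->
        start K n0 (pcomp x' e) = start K n0 x0].
Proof.
move=> Dec_dense.
pose L n := [seq (p, i) | p <- starts K n, i <- iota 0 (n + l)].
pose P n (pi : (seq nat * seq nat) * nat) e := forall z, finite_connection z ->
  (forall a, (a < K)%N -> (z.2 a < n)%N) -> start K n z = pi.1 -> exists n0 x0,
  [/\ finite_connection x0, Dec pi.2 n0 x0 &
      forall x, finite_connection x -> (forall a, (a < K)%N -> (x.2 a < n)%N) ->
        start K n x = pi.1 -> start K n0 (pcomp x e) = start K n0 x0].
(* From position [M] on, [e] is a translation, so that it can still be composed
   with a connection that inserts an arbitrary word at position [M]. *)
pose Q n (e : pairing) := exists M,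
  (forall k, e.1 (M + k)%N = (n + k)%N /\ e.2 (n + k)%N = (M + k)%N) /\
  (forall y, (y < M)%N -> (e.1 y < n)%N).
have [||||e eE eP] := @fusion _ L P Q.
- by exists 0%N; split.
- move=> n e [M [Me Mn]]; exists M.+1; split=> [k|y].
    by rewrite !addSnnS; exact: Me.
  rewrite ltnS leq_eqVlt => /orP[/eqP ->|/Mn]; last by lia.
  by have [] := Me 0%N; rewrite !addn0 => ->.
- move=> n [p i] e d dE dn Pe z zK zn zp.
  have [n0 [x0 [x0K x0D x0P]]] := Pe z zK zn zp; exists n0, x0; split=> //.
  move=> x xK xn xp; rewrite compA; apply: x0P.
  + exact: finite_connection_comp.
  + by move=> a aK /=; rewrite (dn _ (xn _ aK)).2; exact: xn.
  + by rewrite start_comp.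
- move=> n [p i] e eE [M [Me Mn]].
  have [[z [zK zn zp]]|nz] := pselect (exists z, [/\ finite_connection z,
      (forall a, (a < K)%N -> (z.2 a < n)%N) & start K n z = p]); last first.
    exists idp; rewrite comp_idp; split=> //; first by exists M.
    by move=> z zK zn zp; case: nz; exists z.
  have [n0 [x0 [x0K Mn0 /startP[x0s x0j] x0D]]] :=
    Dec_dense i M _ (finite_connection_comp zK eE).
  have [zK' zb] := zK; have [x0K' x0b] := x0K; have [_ z2 _] := zK'.
  pose N := (n0 - M)%N.
  (* [d] inserts the letters of [x0] from [M] to [n0 - 1] at position [n]. A letter is entered as
     the position of its mark in [z], so that every [x] with the same start as [z] restores it. *)
  pose ins y := z.2 (x0.1 (M + (y - n))%N).
  have insn y : (ins y < n)%N by exact: zn.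
  pose d : pairing :=
    (fun y => if (y < n)%N then y else if (y < n + N)%N then ins y else (y - N)%N,
     fun y => if (y < n)%N then y else (y + N)%N).
  have dn : fixes n d by move=> y yn; rewrite /= yn.
  have dE : connection d.
    apply: connectionP => [a b ab|a|a y] /=.
    + by case: (ltnP a n); case: (ltnP b n); lia.
    + case: (ltnP a n) => an; rewrite ?an //.
      by case: (ltnP (a + N) n); case: (ltnP (a + N) (n + N)); lia.
    + case: (ltnP a n) => an ya; first by rewrite (leq_ltn_trans ya an).
      by case: ltnP => yn; [lia|case: ltnP => yN; have := insn y; lia].
  exists d; split=> //.
    exists (M + N)%N; split=> [k|y yMN] /=.
      rewrite -addnA (Me _).1; split.
        by case: (ltnP (n + (N + k)) n); case: (ltnP (n + (N + k)) (n + N)); lia.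
      rewrite ltnNge leq_addr /= -addnA (Me _).2; lia.
    have [/Mn yn|yM] := ltnP y M; first by rewrite yn.
    have := (Me (y - M)%N).1; rewrite subnKC // => ->.
    have -> : (n + (y - M) < n)%N = false by lia.
    by case: (ltnP (n + (y - M)) (n + N)); [move=> _; exact: insn|lia].
  move=> _ _ _ _; exists n0, x0; split=> // x xK xn; rewrite -zp => /startP[xs xj].
  apply/startP; split=> [y yn0|a aK] /=; last first.
    by rewrite xn // xj // x0j.
  have [yM|yM] := ltnP y M.
    by rewrite (Mn _ yM) xs ?Mn // x0s.
  have := (Me (y - M)%N).1; rewrite subnKC // => ->.
  have -> : (n + (y - M) < n)%N = false by lia.
  rewrite ifT; last by rewrite /N; lia.
  by rewrite /ins addKn subnKC // xs ?zn // z2.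
exists e => // i n x xK xn il.
have xL : (start K n x, i) \in L n.
  apply: allpairs_f; last by rewrite mem_iota.
  by apply: mem_starts => // y _; exact: xK.2.
have [n0 [x0 [x0K x0D x0P]]] := eP n _ xL x xK xn erefl.
exists n0, x0; split=> // x' x'K x'x; apply: x0P => // a aK.
by have [_ ->] := (startP K n x' x).1 x'x; [exact: xn|].
Qed.

End generic.

(** * The property of Baire *)

Section baire_property.
Context (T : topologicalType).
Implicit Types A B G U V : set T.

Definition comeager G := exists2 D : nat -> set T,
  forall i, open (D i) /\ dense (D i) & \bigcap_i D i `<=` G.

Lemma comeagerS G G' : G `<=` G' -> comeager G -> comeager G'.
Proof. by move=> GG' [D Do DG]; exists D => //; exact: subset_trans GG'. Qed.

Lemma comeager_bigcap (J : countType) (G : J -> set T) :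
  (forall i, comeager (G i)) -> comeager (\bigcap_i G i).
Proof.
move=> Gc; have /choice[D DP] : forall i, exists D : nat -> set T,
    (forall n, open (D n) /\ dense (D n)) /\ \bigcap_n D n `<=` G i.
  by move=> i; have [D ? ?] := Gc i; exists D.
exists (fun k => if unpickle k is Some (i, n) then D i n else setT).
  move=> k; case: unpickle => [[i n]|]; first exact: (DP i).1.
  by split; [exact: openT|move=> O O0 _; rewrite setIT].
move=> z Dz i _; apply: (DP i).2 => n _.
by have := Dz (pickle (i, n)) I; rewrite pickleK.
Qed.

Lemma comeager_open_dense U : open U -> dense U -> comeager U.
Proof. by move=> Uo Ud; exists (fun=> U) => // z /(_ 0 I). Qed.

Lemma comeagerT : comeager setT.
Proof.
by apply: comeager_open_dense; [exact: openT|move=> O O0 _; rewrite setIT].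
Qed.

Lemma comeagerI G G' : comeager G -> comeager G' -> comeager (G `&` G').
Proof.
move=> Gc G'c; rewrite -bigcap2E.
by apply: comeager_bigcap => -[|[|n]] //=; exact: comeagerT.
Qed.

(** With one open set for [B] and one for its complement, complementation is a swap, and each color
    yields a dense open set of points where membership is decided. *)
Definition baire_property B := exists U V, [/\ open U, open V, dense (U `|` V) &
  comeager [set z | (U z -> B z) /\ (V z -> ~ B z)]].

Lemma dense_interior_setC U : open U -> dense (U `|` (~` U)°).
Proof.
move=> Uo O [z Oz] Oo.
have [[t [Ot Ut]]|OU] := pselect (exists t, O t /\ U t); first by exists t; split=> //; left.
exists z; split=> //; right.
apply: filterS (open_nbhs_nbhs (conj Oo Oz)) => t Ot Ut; apply: OU.
by exists t.
Qed.

Lemma borel_baire_property B : borel B -> baire_property B.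
Proof.
apply; split; first split.
- exists set0, setT; split; [exact: open0|exact: openT| |].
    by move=> O O0 _; rewrite set0U setIT.
  by apply: comeagerS comeagerT => z _; split=> // _ [].
- move=> A [U [V [Uo Vo UV UVA]]]; exists V, U; split=> //.
    by rewrite setUC.
  apply: comeagerS UVA => z [UA VA]; split=> [/VA nA|/UA Az [_]//].
  by split.
- move=> A /choice[U /choice[V UVP]].
  pose U' := \bigcup_k U k.
  have U'o : open U' by apply: bigcup_open => k _; case: (UVP k).
  exists U', (~` U')°; split=> //; [exact: open_interior|exact: dense_interior_setC|].
  (* A point of [G k] outside [U k] is in [V k]; so a point of all [G k] outside every [U k] is in
     no [A k]. *)
  pose G k := [set z | (U k z -> A k z) /\ (V k z -> ~ A k z)] `&` (U k `|` V k).
  have Gc k : comeager (G k).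
    have [Uo Vo UV UVA] := UVP k; apply: comeagerI => //.
    by apply: comeager_open_dense => //; exact: openU.
  apply: comeagerS (comeager_bigcap Gc) => z Gz; split=> [[k _ Uz]|Vz [k _ Az]].
    by exists k => //; have [[UA _] _] := Gz k I; exact: UA.
  have [[_ VA] [Uz|/VA //]] := Gz k I.
  by apply: (interior_subset Vz); exists k.
- move=> U Uo; exists U, (~` U)°.
  split; [exact: Uo|exact: open_interior|exact: dense_interior_setC|].
  by apply: comeagerS comeagerT => z _; split=> // /interior_subset.
Qed.

End baire_property.

(** * The topology in coordinates *)

Lemma ptws_cvg (I : eqType) (X : topologicalType) (F : set_system (I -> X)) (f : I -> X) :
  Filter F -> (forall i, (fun g => g i) @ F --> f i) -> {ptws, F --> f}.
Proof.
move=> FF Ff; apply/cvg_sup => i; apply/cvg_image.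
  by rewrite eqEsubset; split=> v // _; exists (cst v).
move=> A /(Ff i) FA; exists ((fun g => g i) @^-1` A) => //.
by rewrite eqEsubset; split=> [_ [? + <-]//|v Av]; exists (cst v).
Qed.

Section coordinates.
Context (K : nat).

Definition of_connections (z : connections nat 'I_K) : pairing :=
  (fun y => val ((val z).1 y), fun a => if insub a is Some b then (val z).2 b else 0).

Lemma of_connections_finite z : finite_connection K (of_connections z).
Proof.
case: z => -[s j] /= zP; have /set_mem[/= js sj sle] := zP.
split=> /= [|y]; last exact: ltn_ord.
split=> /= [a b ab bK|a aK|a y aK].
- rewrite !insubT ?(ltn_trans ab) //= => aK.
  have := js (Ordinal aK) (Ordinal bK); rewrite ltEord; exact.
- by rewrite insubT /= sj.
- by rewrite insubT /= => /sle; rewrite leEord.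
Qed.

Definition to_map_pair x (xP : finite_connection K x) : map_pair nat 'I_K :=
  (fun y => Ordinal (xP.2 y), fun a : 'I_K => x.2 a).

Lemma to_map_pair_connections x (xP : finite_connection K x) :
  to_map_pair xP \in connections nat 'I_K.
Proof.
case: (xP) => -[x1 x2 x3] xb; apply/mem_set; split=> /= [a b ab|a|a y ya].
- exact: x1.
- by apply: val_inj => /=; rewrite x2.
- by rewrite leEord /=; exact: x3.
Qed.

Definition to_connections x (xP : finite_connection K x) : connections nat 'I_K :=
  exist _ (to_map_pair xP) (to_map_pair_connections xP).

Lemma start_to_connections n x (xP : finite_connection K x) :
  start K n (of_connections (to_connections xP)) = start K n x.
Proof. by apply/startP; split=> // a aK /=; rewrite insubT. Qed.

Lemma nbhs_connections (z : connections nat 'I_K) (A : set (connections nat 'I_K)) :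
  nbhs z A <-> exists n, forall z',
    start K n (of_connections z') = start K n (of_connections z) -> A z'.
Proof.
split=> [|[n nA]]; last first.
  have val_continuous : continuous (set_val : connections nat 'I_K -> map_pair nat 'I_K).
    exact: initial_continuous.
  have near_s y : \forall z' \near z, (val z').1 y = (val z).1 y.
    apply: (val_continuous z [set x | x.1 y = (val z).1 y]).
    exists ([set f | f y = (val z).1 y], setT) => [|[f g] []//]; split; last exact: filterT.
    apply: (@proj_continuous nat (fun=> discrete_topology 'I_K) y (val z).1 [set (val z).1 y]).
    exact: discrete_set1.
  have near_j a : \forall z' \near z, (val z').2 a = (val z).2 a.
    apply: (val_continuous z [set x | x.2 a = (val z).2 a]).
    exists (setT, [set f | f a = (val z).2 a]) => [|[f g] []//]; split; first exact: filterT.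
    apply: (@proj_continuous 'I_K (fun=> discrete_topology nat) a (val z).2 [set (val z).2 a]).
    exact: discrete_set1.
  pose T : Type := connections nat 'I_K.
  have near_ss : nbhs z [set z' : T | forall y : 'I_n, (val z').1 y = (val z).1 y].
    apply: (@filter_forall _ _ (fun (y : 'I_n) (z' : T) => (val z').1 y = (val z).1 y)
      (nbhs z) (nbhs_filter z)) => y; exact: near_s.
  have near_jj : nbhs z [set z' : T | forall a, (val z').2 a = (val z).2 a].
    apply: (@filter_forall _ _ (fun a (z' : T) => (val z').2 a = (val z).2 a)
      (nbhs z) (nbhs_filter z)) => a; exact: near_j.
  apply: filterS (filterI near_ss near_jj) => z' [zs zj]; apply: nA.
  apply/startP; split=> /= [y yn|a aK]; first by rewrite (zs (Ordinal yn)).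
  by case: insubP => // b _ _; rewrite zj.
(* The filter of basic open sets at [z] converges to [z] because it does so in each coordinate. *)
pose F := filter_from setT (fun n =>
  [set z' | start K n (of_connections z') = start K n (of_connections z)]).
have FF : Filter F.
  apply: filter_from_filter; first by exists 0.
  move=> m n _ _; exists (maxn m n) => // z' /startP[zs zj].
  by split; apply/startP; split=> // y yn; apply: zs; rewrite leq_max yn ?orbT.
suff Fz : F --> z by move=> /Fz[n _ nA]; exists n.
move=> B [_ [[C Co <-] Cz CB]]; apply: filterS CB _.
have [[P Q] [/= Pz Qz] PQC] : nbhs (set_val z) C by exact: open_nbhs_nbhs.
have FP : F [set z' : connections nat 'I_K | P (val z').1].
  apply: (@ptws_cvg nat (discrete_topology 'I_K)
    (fmap (fun z' : connections nat 'I_K => (val z').1) F) _ _ _ P Pz).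
  move=> y; apply/discrete_cvg; exists y.+1 => // z' /startP[zs _].
  exact/val_inj/(zs y).
have FQ : F [set z' : connections nat 'I_K | Q (val z').2].
  apply: (@ptws_cvg 'I_K (discrete_topology nat)
    (fmap (fun z' : connections nat 'I_K => (val z').2) F) _ _ _ Q Qz).
  move=> a; apply/discrete_cvg; exists 0 => // z' /startP[_ /(_ _ (ltn_ord a))].
  by rewrite /= valK.
by apply: filterS (filterI FP FQ) => z' [? ?]; exact: PQC.
Qed.

Lemma dense_connections (S : set (connections nat 'I_K)) n x :
  open S -> dense S -> finite_connection K x -> exists n' x',
    [/\ finite_connection K x', (n <= n')%N, start K n x' = start K n x &
      forall z, start K n' (of_connections z) = start K n' x' -> S z].
Proof.
move=> So Sd xK; pose z := to_connections xK.
pose N := [set z' | start K n (of_connections z') = start K n (of_connections z)].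
have Nz : nbhs z N by apply/nbhs_connections; exists n.
have [||z' [/interior_subset Nz' Sz']] := Sd N°.
- by exists z.
- exact: open_interior.
have [n' n'S] := (nbhs_connections z' S).1 (open_nbhs_nbhs (conj So Sz')).
exists (maxn n n'), (of_connections z'); split.
- exact: of_connections_finite.
- exact: leq_maxl.
- by rewrite Nz' start_to_connections.
- move=> t /startP[ts tj]; apply: n'S; apply/startP; split=> // y yn.
  by apply: ts; rewrite leq_max yn orbT.
Qed.

End coordinates.

(** * Reduction of Borel colorings to finite parts *)

Lemma agree_to_mark_connects K x x' :
  connects K x -> agree_to_mark K x x' -> connects K x'.
Proof.
move=> [x1 x2 x3] xx'; split=> [a b ab bK|a aK|a y aK ya].
- by rewrite -(xx' a (ltn_trans ab bK)).1 -(xx' b bK).1; exact: x1.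
- by have [<- <- //] := xx' a aK; exact: x2.
- move: ya; have [<- xs] := xx' a aK => ya; rewrite -xs //; exact: x3.
Qed.

(** Beyond the last mark [x.1] is unrestricted; truncation at [K] changes nothing up to that
    mark. *)
Lemma finite_connection_clamp K x : connects K.+1 x ->
  finite_connection K.+1 (fun y => minn (x.1 y) K, x.2).
Proof.
move=> [x1 x2 x3]; split=> [|y] /=; last by rewrite ltnS geq_minr.
split=> //= [a aK|a y aK ya]; first by rewrite x2 //; apply/minn_idPl.
by rewrite geq_min x3.
Qed.

Lemma continuous_restriction l K (chi : connections nat 'I_K -> 'I_l) :
  (forall m, baire_property (chi @^-1` [set m])) ->
  exists2 e, connection e & forall x x' (xP : finite_connection K x)
    (xP' : finite_connection K x') (xeP : finite_connection K (pcomp x e))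
    (xeP' : finite_connection K (pcomp x' e)),
    agree_to_mark K x x' -> chi (to_connections xeP) = chi (to_connections xeP').
Proof.
move=> /choice[U /choice[V UVP]].
have [D DP DG] : comeager (\bigcap_m
    [set z | (U m z -> chi z = m) /\ (V m z -> chi z <> m)]).
  by apply: comeager_bigcap => m; have [] := UVP m.
pose dec (S : set (connections nat 'I_K)) n x :=
  forall z, start K n (of_connections z) = start K n x -> S z.
(* The first [l] questions decide the colors; the others put points into the dense open sets [D]. *)
pose Dec i n x := if insub i is Some m then dec (U m) n x \/ dec (V m) n x
  else dec (D (i - l)%N) n x.
have [i n x xP|e eE eP] := @generic_connection K l Dec.
  rewrite /Dec; case: insubP => [m _ _|_].
    have [Uo Vo UVd _] := UVP m.
    have [z zUV nz] : exists2 z, (U m `|` V m) z &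
        start K n (of_connections z) = start K n x.
      have [n' [x' [x'P nn' x'x x'S]]] := dense_connections n (openU Uo Vo) UVd xP.
      exists (to_connections x'P); last by rewrite start_to_connections.
      by apply: x'S; rewrite start_to_connections.
    have [n' n'z] : exists n', dec (U m) n' (of_connections z) \/
        dec (V m) n' (of_connections z).
      case: zUV => [Uz|Vz].
        have [n' n'U] := (nbhs_connections z _).1 (open_nbhs_nbhs (conj Uo Uz)).
        by exists n'; left.
      have [n' n'V] := (nbhs_connections z _).1 (open_nbhs_nbhs (conj Vo Vz)).
      by exists n'; right.
    have mon (S : set (connections nat 'I_K)) : dec S n' (of_connections z) ->
        dec S (maxn n n') (of_connections z).
      move=> dS t /startP[ts tj]; apply: dS; apply/startP; split=> // y yn.
      by apply: ts; rewrite leq_max yn orbT.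
    exists (maxn n n'), (of_connections z); split=> //.
    - exact: of_connections_finite.
    - exact: leq_maxl.
    - by case: n'z => /mon; [left|right].
  have [Do Dd] := DP (i - l)%N.
  exact: dense_connections.
exists e => // x x' xP xP' xeP xeP' xx'.
have inD y (yP : finite_connection K y) (yeP : finite_connection K (pcomp y e)) i :
    D i (to_connections yeP).
  (* Long enough to contain the marks of [y] and to reach question [i + l]. *)
  pose n := (mark_length K y + i.+1)%N.
  have yn a : (a < K)%N -> (y.2 a < n)%N.
    by move=> /(mark_lengthP yP.1) ay; apply: leq_trans ay (leq_addr _ _).
  have il : (i + l < n + l)%N by rewrite /n; lia.
  have [n0 [x0 [x0P + x0e]]] := eP _ _ _ yP yn il.
  rewrite /Dec insubF; last by apply/negbTE; rewrite -leqNgt leq_addl.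
  by rewrite addnK; apply; rewrite start_to_connections; exact: x0e.
have inG y (yP : finite_connection K y) (yeP : finite_connection K (pcomp y e)) m :
    (U m (to_connections yeP) -> chi (to_connections yeP) = m) /\
    (V m (to_connections yeP) -> chi (to_connections yeP) <> m).
  by apply: DG => // i _; exact: inD.
pose m := chi (to_connections xeP); apply/esym.
have il : (m < mark_length K x + l)%N by rewrite ltn_addl.
(* Color questions are already available at length [mark_length K x], so the decision depends only
   on the part up to the last mark. *)
have [n0 [x0 [x0P + x0e]]] := eP _ _ _ xP (fun a => mark_lengthP xP.1) il.
have [xn xs] := (agree_to_markP x' xP.1).1 xx'.
rewrite /Dec valK => -[dU|dV].
  apply: (inG _ xP' xeP' m).1; apply: dU; rewrite start_to_connections.
  by apply: x0e => //; rewrite xs xn.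
have [] := (inG _ xP xeP m).2 _ erefl.
by apply: dV; rewrite start_to_connections; exact: x0e.
Qed.

Lemma connection_connections e : connection e -> (e : map_pair nat nat) \in connections nat nat.
Proof.
move=> eE; apply/mem_set; split=> /= [x y|x|x y].
- by rewrite !ltEnat /= connection_incr.
- exact: connection_cancel.
- by rewrite !leEnat; exact: connection_bound.
Qed.

Theorem theorem2 (K l : nat) (l_gt0 : (0 < l)%N)
    (chi : connections nat 'I_K -> 'I_l) :
  (forall m : 'I_l, borel (chi @^-1` [set m])) ->
  exists rc0 : connections nat nat,
    monochromatic chi [set conn_comp sj rc0 | sj in [set: connections nat 'I_K]].
Proof.
case: K chi => [|K] chi chiB.
  (* There are no connections from omega to 0, and any color will do. *)
  exists (exist _ (idp : map_pair nat nat) (connection_connections connection_idp)).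
  exists (Ordinal l_gt0) => z [sj _ _]; by have [] := (val sj).1 0.
have [e eE eP] := continuous_restriction (fun m => borel_baire_property (chiB m)).
pose clamp (x : pairing) : pairing := (fun y => minn (x.1 y) K, x.2).
have clampP x : connects K.+1 x -> finite_connection K.+1 (pcomp (clamp x) e).
  by move=> xK; apply: finite_connection_comp => //; exact: finite_connection_clamp.
pose chi' x := if pselect (connects K.+1 x) is left xK
  then chi (to_connections (clampP x xK)) else Ordinal l_gt0.
have [x x' xK xx'|e' e'E [m em]] := @marks_ramsey l K.+1 chi'.
  rewrite /chi'; case: pselect => // xK'; case: pselect => [x'K|[]]; last first.
    exact: agree_to_mark_connects xx'.
  apply: (eP _ _ (finite_connection_clamp xK') (finite_connection_clamp x'K)).
  by move=> a /xx'[xa xs]; split=> // y /xs /= ->.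
exists (exist _ (pcomp e' e : map_pair nat nat)
  (connection_connections (connection_comp e'E eE))).
exists m => _ [z _ <-]; rewrite /preimage /= -(em (of_connections z)).
  have zK := (of_connections_finite z).1.
  rewrite /chi'; case: pselect => [zK'|[]]; last exact: connects_comp.
  congr chi; apply: val_inj; congr pair; apply/funext => y /=.
    by apply: val_inj => /=; rewrite (minn_idPl _) // -ltnS ltn_ord.
  by rewrite valK.
exact: (of_connections_finite z).1.
Qed.
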